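(* Let $m\in(0,1)$ be fixed and let $K=ABC$ be an arbitrary (nondegenerate) triangle in the plane. Let $M$, $N$, $P$ be the points on the sides $AB$, $BC$, $CA$ respectively such that $AM:MB=BN:NC=CP:PA=m:(1-m)$, and let $K'=MNP$. Then $$\frac{\Delta(K')}{\Delta(K)}=1-3m(1-m).$$
   Context: $\Delta(\cdot)$ denotes the area of a polygon. The triangle $K'$ is called the first $m$-Kasner descendant of $K$. The condition $AM:MB=m:(1-m)$ means that $M$ lies on segment $AB$ with $\overrightarrow{AM}=m\,\overrightarrow{AB}$, and similarly for the other points. *)

(* Defs.v *)
From HB Require Import structures.
From mathcomp Require Import all_boot all_order all_algebra.
From mathcomp Require Import all_classical all_reals all_analysis.

Set Implicit Arguments.
Unset Strict Implicit.
Unset Printing Implicit Defensive.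

Import Order.TTheory GRing.Theory Num.Theory.
Import numFieldNormedType.Exports.

Local Open Scope classical_set_scope.
Local Open Scope ring_scope.

                                                                             
Definition triangle (R : realType) (A B C : R * R) : set (R * R) :=
  [set X | exists a b c : R,
     [/\ 0 <= a, 0 <= b, 0 <= c, a + b + c = 1 &
         X = a *: A + b *: B + c *: C]].

Definition collinear (R : realType) (A B C : R * R) : Prop :=
  exists X d : R * R, d <> 0 /\
    exists a b c : R, [/\ A = X + a *: d, B = X + b *: d & C = X + c *: d].

                                                                          
                                                       
Definition area (R : realType) (S : set (R * R)) : R :=
  fine ((@lebesgue_measure R \x @lebesgue_measure R)%E S).

(* Main.v *)
Require Import Defs.
From mathcomp Require Import all_boot all_order all_algebra.
From mathcomp Require Import all_classical all_reals all_analysis.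
From mathcomp Require Import measurable_realfun ring lra.

Import Order.TTheory GRing.Theory Num.Theory.
Import numFieldNormedType.Exports.

Local Open Scope classical_set_scope.
Local Open Scope ring_scope.

(** Slicing a triangle by vertical lines, the length of the slice is affine in the
    abscissa on each side of the middle vertex; integrating it, the area is half the
    absolute value of the determinant of two edge vectors. Replacing [ABC] by [MNP]
    multiplies this determinant by [1 - 3 m (1 - m)], which is positive. *)

(** * Determinants, collinearity and barycentric coordinates *)

Definition det3 {R : realType} (A B C : R * R) : R :=
  (B.1 - A.1) * (C.2 - A.2) - (B.2 - A.2) * (C.1 - A.1).

(** The direction of the line must be nonzero: it is [B - A] if [A] and [B] differ, else [C - A] if
    that is nonzero, else an arbitrary vector. *)
Lemma det3_eq0_collinear (R : realType) (A B C : R * R) :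
  det3 A B C = 0 -> collinear A B C.
Proof.
case: A B C => [a1 a2] [b1 b2] [c1 c2]; rewrite /det3 /= => D0.
exists (a1, a2).
have [|b1n] := eqVneq b1 a1; last first.
  exists (b1 - a1, b2 - a2); split.
    by case=> /eqP; rewrite subr_eq0 (negbTE b1n).
  exists 0, 1, ((c1 - a1) / (b1 - a1)).
  rewrite -subr_eq0 in b1n.
  split; congr pair => /=; rewrite /GRing.scale /=; try ring; try by field.
  have tE : (c1 - a1) / (b1 - a1) * (b1 - a1) = c1 - a1 by rewrite divfK.
  move: tE; set t := (c1 - a1) / (b1 - a1) => tE.
  apply: (mulfI b1n).
  transitivity ((b1 - a1) * a2 + t * (b1 - a1) * (b2 - a2)); last ring.
  by rewrite tE; lra.
move=> b1E; subst b1; have [b2E|b2n] := eqVneq b2 a2; last first.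
  exists (0, b2 - a2); split.
    by case=> /eqP; rewrite subr_eq0 (negbTE b2n).
  exists 0, 1, ((c2 - a2) / (b2 - a2)).
  rewrite -subr_eq0 in b2n.
  split; congr pair => /=; rewrite /GRing.scale /=; try ring; try by field.
  by apply: (mulfI b2n); lra.
subst b2; have [cE|cn] := eqVneq (c1 - a1, c2 - a2) 0; last first.
  exists (c1 - a1, c2 - a2); split; first exact/eqP.
  by exists 0, 0, 1; split; congr pair => /=; rewrite /GRing.scale /=; ring.
exists (1, 0); split; first by case=> /eqP; rewrite oner_eq0.
case: cE => c1E c2E.
by exists 0, 0, 0; split; congr pair => /=; rewrite /GRing.scale /=; lra.
Qed.

Lemma triangle_swap (R : realType) (A B C : R * R) :
  triangle A B C = triangle B A C.
Proof.
by apply/seteqP; split=> X [a [b [c [a0 b0 c0 s ->]]]];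
  exists b, a, c; (split=> //; [lra | rewrite [b *: _ + _]addrC]).
Qed.

Lemma triangle_rot (R : realType) (A B C : R * R) :
  triangle A B C = triangle B C A.
Proof.
apply/seteqP; split=> X [a [b [c [a0 b0 c0 s ->]]]].
  by exists b, c, a; split=> //; [lra | rewrite -addrA addrC].
by exists c, a, b; split=> //; [lra | rewrite addrC addrA].
Qed.

(** Cramer's rule: the three quotients are the barycentric coordinates of [X]. *)
Lemma triangleP (R : realType) (A B C X : R * R) : det3 A B C != 0 ->
  triangle A B C X <-> [/\ 0 <= det3 X B C / det3 A B C,
    0 <= det3 A X C / det3 A B C & 0 <= det3 A B X / det3 A B C].
Proof.
move=> D0; split.
  case=> a [b [c [a0 b0 c0 s XE]]].
  have aE : a = 1 - b - c by lra.
  suff [-> -> ->] : [/\ det3 X B C = a * det3 A B C,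
    det3 A X C = b * det3 A B C & det3 A B X = c * det3 A B C].
    by rewrite !mulfK.
  rewrite XE aE /det3 /= /GRing.scale /=.
  by split; ring.
case=> a0 b0 c0.
exists (det3 X B C / det3 A B C), (det3 A X C / det3 A B C),
  (det3 A B X / det3 A B C); split=> //.
  move: D0; rewrite /det3; case: X A B C {a0 b0 c0} => [? ?] [? ?] [? ?] [? ?]/= ?.
  by field.
move: D0; rewrite /det3; case: X A B C {a0 b0 c0} => [? ?] [? ?] [? ?] [? ?]/= ?.
by congr pair; rewrite /= /GRing.scale /=; field.
Qed.

(** * Measurability and vertical slices *)

Lemma measurable_triangle (R : realType) (A B C : R * R) :
  det3 A B C != 0 -> measurable (triangle A B C).
Proof.
move=> D0.
have m1 (f : R * R -> R) : measurable_fun setT f -> measurable [set X | 0 <= f X].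
  move=> mf; rewrite -[X in measurable X]setTI.
  have -> : [set X | 0 <= f X] = f @^-1` `[0, +oo[.
    by apply/seteqP; split=> X /=; rewrite in_itv/= andbT.
  exact: mf.
(* The triangle is an intersection of three half-planes, each given by the sign of a polynomial in
   the coordinates of [X]. *)
have -> : triangle A B C = [set X | 0 <= det3 X B C / det3 A B C] `&`
   [set X | 0 <= det3 A X C / det3 A B C] `&`
   [set X | 0 <= det3 A B X / det3 A B C].
  apply/seteqP; split=> X.
    by move/(triangleP _ _ _ _ _ D0) => [].
  by move=> [[? ?] ?]; apply/(triangleP _ _ _ _ _ D0).
have mcf (f : R * R -> R) k : measurable_fun setT f ->
    measurable_fun setT (fun X => f X / k).
  by move=> mf; apply: measurable_funM.
have m : measurable_fun setT (@fst R R) by exact: measurable_fst.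
have m' : measurable_fun setT (@snd R R) by exact: measurable_snd.
by apply: measurableI; [apply: measurableI|]; apply: m1; apply: mcf;
  repeat first [apply: measurable_funB | apply: measurable_funM
   | exact: m | exact: m' | exact: measurable_cst].
Qed.

(** Parametrizing by [w] avoids deciding which endpoint is the larger, which for a slice depends on
    the orientation of the triangle. *)
Lemma lebesgue_measure_segment (R : realType) (p q : R) :
  @lebesgue_measure R
    [set y | exists2 w, 0 <= w <= 1 & y = w * p + (1 - w) * q]
  = `|p - q|%:E.
Proof.
wlog pq : p q / p <= q.
  move=> H; have [|/ltW qp] := leP p q; first exact: H.
  rewrite distrC -H//; congr (lebesgue_measure _).
  by apply/seteqP; split=> y [w w01 ->]; exists (1 - w); lra.
have -> : [set y | exists2 w, 0 <= w <= 1 & y = w * p + (1 - w) * q]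
    = `[p, q]%classic.
  apply/seteqP; split=> y /=; rewrite in_itv/=.
    by move=> [w w01 ->]; nra.
  move=> yI; have [pqE|pqn] := eqVneq p q.
    by exists 0; lra.
  have qp : 0 < q - p by rewrite subr_gt0 lt_neqAle pqn.
  exists ((q - y) / (q - p)).
    by rewrite divr_ge0 ?ler_pdivrMr//=; lra.
  by field; rewrite gt_eqF.
rewrite lebesgue_measure_itv/= lte_fin.
case: ltP => [lt|ge]; first by rewrite ler0_norm ?opprB// subr_le0.
by have -> : p = q; [lra | rewrite subrr normr0].
Qed.

(* In the coordinates b, c with X = A + b (B - A) + c (C - A), the vertical line
   is b / s + c / t = 1, so it cuts the triangle in a segment joining AB to AC. *)
Lemma lebesgue_measure_xsection_triangle (R : realType) (A B C : R * R) (x : R) :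
  let s := (x - A.1) / (B.1 - A.1) in let t := (x - A.1) / (C.1 - A.1) in
  0 < s <= 1 -> 0 < t <= 1 ->
  @lebesgue_measure R (xsection (triangle A B C) x) =
  (`|det3 A B C| * `|x - A.1| / (`|B.1 - A.1| * `|C.1 - A.1|))%:E.
Proof.
case: A B C => [a1 a2] [b1 b2] [c1 c2] s t /=; rewrite /= in s t *.
move=> /andP[s0 s1] /andP[t0 t1].
have B0 : b1 - a1 != 0.
  by apply: contraTneq s0; rewrite /s => ->; rewrite invr0 mulr0 ltxx.
have C0 : c1 - a1 != 0.
  by apply: contraTneq t0; rewrite /t => ->; rewrite invr0 mulr0 ltxx.
have xs : x - a1 = s * (b1 - a1) by rewrite divfK.
have xt : x - a1 = t * (c1 - a1) by rewrite divfK.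
have x0 : x - a1 != 0 by rewrite xs mulf_neq0// gt_eqF.
rewrite -!normrM -normfV -normrM.
(* The vertical line meets [AB] and [AC] at the ordinates [a2 + s * (b2 - a2)] and
   [a2 + t * (c2 - a2)]; the claimed length is their distance. *)
have -> : det3 (a1, a2) (b1, b2) (c1, c2) * (x - a1) / ((b1 - a1) * (c1 - a1)) =
   - ((a2 + s * (b2 - a2)) - (a2 + t * (c2 - a2))).
  by rewrite /det3 /s /t/=; field; rewrite B0 C0.
rewrite normrN -lebesgue_measure_segment; congr (lebesgue_measure _).
apply/seteqP; split=> y; rewrite /xsection /= inE.
  case=> a [b [c [ha hb hc sum]]] [/=]; rewrite /GRing.scale /= => x_ y_.
  have bc : b * (b1 - a1) + c * (c1 - a1) = x - a1.
    by rewrite x_; (have -> : a = 1 - b - c by lra); ring.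
  have bs : b / s + c / t = 1.
    rewrite /s /t; apply: (mulfI x0); rewrite mulr1 -[RHS]bc.
    by field; rewrite B0 C0 x0.
  have b0 : 0 <= b / s by rewrite divr_ge0// ltW.
  have c0 : 0 <= c / t by rewrite divr_ge0// ltW.
  exists (b / s); first lra.
  have -> : 1 - b / s = c / t by rewrite -bs addrAC subrr add0r.
  have -> : y = a2 + b * (b2 - a2) + c * (c2 - a2).
    by rewrite y_; (have -> : a = 1 - b - c by lra); ring.
  have -> : b / s * (a2 + s * (b2 - a2)) + c / t * (a2 + t * (c2 - a2)) =
     (b / s + c / t) * a2 + b / s * s * (b2 - a2) + c / t * t * (c2 - a2) by ring.
  by rewrite bs mul1r !divfK// gt_eqF.
case=> w /andP[w0 w1] ->.
(* Barycentric coordinates of the point dividing the slice with weights [w] and [1 - w]; the first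
   is nonnegative because [s] and [t] are at most 1. *)
exists (1 - s * w - t * (1 - w)), (s * w), (t * (1 - w)); split.
- nra.
- by rewrite mulr_ge0// ltW.
- by rewrite mulr_ge0 ?subr_ge0// ltW.
- ring.
congr pair; rewrite /= /GRing.scale /=; last ring.
suff : x = a1 + w * (s * (b1 - a1)) + (1 - w) * (t * (c1 - a1)) by move=> ->; ring.
by rewrite -xs -xt; ring.
Qed.

(** * Integrating the slice lengths *)

Lemma integral_affine (R : realType) (f : R -> \bar R) (a b p q : R) :
  a <= b -> measurable_fun setT f ->
  (forall x, a < x < b -> f x = (p * x + q)%:E) ->
  (\int[@lebesgue_measure R]_(x in `[a, b]) f x =
   (p * (b ^+ 2 - a ^+ 2) / 2 + q * (b - a))%:E)%E.
Proof.
move=> ab mf fE.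
have mp : measurable_fun setT (fun x => (p * x + q)%:E).
  by apply/measurable_EFinP; apply: measurable_funD => //; apply: measurable_funM.
(* Endpoints are null sets, so the formula for [f] on the open interval suffices. *)
rewrite integral_itv_bndoo; last exact: measurable_funS mf.
transitivity (\int[@lebesgue_measure R]_(x in `]a, b[) (p * x + q)%:E)%E.
  by apply: eq_integral => x; rewrite inE/= in_itv/= => /fE.
rewrite -(@integral_itv_bndoo _ _ _ _ true false); last exact: measurable_funS mp.
move: ab; rewrite le_eqVlt => /predU1P[->|ab].
  by rewrite set_itv1 integral_set1 !subrr !mulr0 mul0r addr0.
pose F x := p / 2 * x ^+ 2 + q * x.
have dF (x : R) : is_derive x 1 F (p * x + q).
  apply: is_derive_eq.
  by rewrite /GRing.scale /=; field.
rewrite (@continuous_FTC2 _ _ F)//.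
- by rewrite -EFinB /F; congr EFin; field.
- apply: continuous_subspaceT => x.
  by apply: cvgD; [apply: cvgM; [exact: cvg_cst|exact: cvg_id]|exact: cvg_cst].
- have cF x : {for x, continuous F}.
    by apply: differentiable_continuous; apply/derivable1_diffP.
  split.
  + by move=> x _.
  + exact/cvg_at_right_filter/cF.
  + exact/cvg_at_left_filter/cF.
- by move=> x _; rewrite derive1E derive_val.
Qed.

Lemma area_triangle_sorted (R : realType) (A B C : R * R) :
  A.1 <= B.1 -> B.1 <= C.1 -> det3 A B C != 0 ->
  area (triangle A B C) = `|det3 A B C| / 2.
Proof.
move=> AB BC D0.
(* Otherwise all three abscissae agree and the determinant vanishes. *)
have AC : A.1 < C.1.
  rewrite lt_neqAle (le_trans AB BC) andbT; apply: contra_neq D0 => ACE.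
  by rewrite /det3 (_ : B.1 = A.1) ?ACE; [ring | lra].
pose L x := @lebesgue_measure R (xsection (triangle A B C) x).
have mL : measurable_fun setT L.
  by apply: measurable_fun_xsection; exact: measurable_triangle.
have L0 x : x \notin `[A.1, C.1] -> L x = 0%E.
  move=> xn; rewrite /L (_ : xsection _ _ = set0) ?measure0//.
  apply/seteqP; split=> y //; rewrite /xsection/= inE.
  move=> [a [b [c [a0 b0 c0 s [xE _]]]]]; move: xn; apply/negP/negPn.
  by rewrite in_itv/= xE /GRing.scale /=; nra.
have LE1 x : A.1 < x < B.1 ->
    L x = (`|det3 A B C| / ((B.1 - A.1) * (C.1 - A.1)) * x
      + - (`|det3 A B C| / ((B.1 - A.1) * (C.1 - A.1)) * A.1))%:E.
  move=> /andP[Ax xB]; rewrite /L lebesgue_measure_xsection_triangle.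
  - have [xA BA CA] : [/\ 0 < x - A.1, 0 < B.1 - A.1 & 0 < C.1 - A.1].
      by split; lra.
    by rewrite (gtr0_norm xA) (gtr0_norm BA) (gtr0_norm CA); congr EFin; ring.
  - by rewrite divr_gt0 ?ler_pdivrMr//=; lra.
  - by rewrite divr_gt0 ?ler_pdivrMr//=; lra.
have LE2 x : B.1 < x < C.1 ->
    L x = (- (`|det3 A B C| / ((C.1 - B.1) * (C.1 - A.1))) * x
      + `|det3 A B C| / ((C.1 - B.1) * (C.1 - A.1)) * C.1)%:E.
  (* To the right of [B] the slice joins [CB] to [CA], so the slice lemma is applied with [C] as
     first vertex. *)
  move=> /andP[Bx xC]; rewrite /L triangle_rot triangle_swap.
  have -> : `|det3 A B C| = `|det3 C B A|.
    by rewrite -normrN; congr (`|_|); rewrite /det3; ring.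
  rewrite lebesgue_measure_xsection_triangle.
  - have [xC' BC' AC'] : [/\ 0 < C.1 - x, 0 < C.1 - B.1 & 0 < C.1 - A.1].
      by split; lra.
    rewrite (distrC x) (distrC B.1) (distrC A.1).
    by rewrite (gtr0_norm xC') (gtr0_norm BC') (gtr0_norm AC'); congr EFin; ring.
  - rewrite -mulrNN -invrN !opprB divr_gt0 ?ler_pdivrMr//=; lra.
  - rewrite -mulrNN -invrN !opprB divr_gt0 ?ler_pdivrMr//=; lra.
rewrite /area /product_measure1.
have -> : (\int[@lebesgue_measure R]_x (@lebesgue_measure R \o
    xsection (triangle A B C)) x = \int[@lebesgue_measure R]_(x in `[A.1, C.1]) L x)%E.
  rewrite [RHS]integral_mkcond; apply: eq_integral => x _.
  by rewrite patchE; case: ifPn => //; rewrite notin_setE => /negP /L0.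
rewrite (@itv_bndbnd_setU _ _ _ (BRight B.1)) ?bnd_simp// ge0_integral_setU//=; first last.
- rewrite disj_set2E; apply/eqP/seteqP; split=> x //=; rewrite !in_itv/=; lra.
- exact: measurable_funS mL.
rewrite integral_itv_obnd_cbnd; last exact: measurable_funS mL.
rewrite (integral_affine _ _ _ _ _ _ AB mL LE1) (integral_affine _ _ _ _ _ _ BC mL LE2)/=.
(* If one side is vertical, one slope contains the inverse of 0, which is 0 by convention; that
   piece contributes nothing and the other gives the whole area. Both equalities together contradict
   [AC]. *)
have [BA|BA] := eqVneq B.1 A.1; have [BC'|BC'] := eqVneq C.1 B.1.
- lra.
- rewrite BA !subrr !(mul0r, mulr0, invr0, oppr0, add0r, addr0).
  by field; lra.
- rewrite BC' !subrr !(mul0r, mulr0, invr0, oppr0, add0r, addr0).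
  by field; lra.
- by field; lra.
Qed.

(** Permuting the vertices keeps the set and changes the determinant at most by a sign, so the
    abscissae may be sorted: first [A] and [B], then [C] is inserted. *)
Lemma area_triangle (R : realType) (A B C : R * R) :
  det3 A B C != 0 -> area (triangle A B C) = `|det3 A B C| / 2.
Proof.
have rot (X Y Z : R * R) : det3 Y Z X = det3 X Y Z by rewrite /det3; ring.
have swap (X Y Z : R * R) : det3 Y X Z = - det3 X Y Z by rewrite /det3; ring.
wlog AB : A B C / A.1 <= B.1.
  move=> H D0; have [|/ltW] := leP A.1 B.1; first by move=> /H; exact.
  by move=> /(H B A C); rewrite triangle_swap swap normrN oppr_eq0; exact.
move=> D0; have [BC|/ltW CB] := leP B.1 C.1; first exact: area_triangle_sorted.
have [AC|/ltW CA] := leP A.1 C.1.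
  rewrite triangle_swap triangle_rot -[det3 A B C]opprK -swap -rot normrN.
  by rewrite area_triangle_sorted// rot swap oppr_eq0.
rewrite -triangle_rot (rot C A B).
by rewrite area_triangle_sorted// -(rot C A B).
Qed.

(** * The determinant of the inscribed triangle *)

Theorem theorem2p1 (R : realType) (m : R) (hm0 : 0 < m) (hm1 : m < 1)
    (A B C : R * R) (hABC : ~ collinear A B C)
    (M N P : R * R)
    (hM : M - A = m *: (B - A))
    (hN : N - B = m *: (C - B))
    (hP : P - C = m *: (A - C)) :
  area (triangle M N P) / area (triangle A B C) = 1 - 3 * m * (1 - m).
Proof.
have D0 : det3 A B C != 0 by apply/eqP => /det3_eq0_collinear.
(* Holds since [m * (1 - m)] is at most 1/4. Hence [MNP] is nondegenerate too, and the factor leaves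
   the absolute value unchanged. *)
have k0 : 0 < 1 - 3 * m * (1 - m) by nra.
have DE : det3 M N P = (1 - 3 * m * (1 - m)) * det3 A B C.
  (* Writing [M] as [M - A + A], and likewise [N] and [P], lets the hypotheses express everything
     through [A], [B], [C]. *)
  rewrite -(subrK A M) -(subrK B N) -(subrK C P) hM hN hP.
  by rewrite /det3 /= /GRing.scale /=; ring.
rewrite !area_triangle ?DE ?mulf_neq0 ?(gt_eqF k0)//.
rewrite normrM (gtr0_norm k0); field.
by rewrite normr_eq0.
Qed.
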